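(* Let $p\in\mathbb N$ and let $X_{\mathrm{nm},p}$ denote the subshift generated by the noble means substitution with parameter $p$. Then $\eta_{\kappa,\ell}^{-1}(X_{\mathrm{nm},p})\subseteq\mathcal A_\kappa^{\mathbb Z}$ (with the left shift) is strictly ergodic for all integers $\kappa,\ell\ge 2$.
   Context: $\mathbb N=\{1,2,\dots\}$, $\mathcal A_\kappa=\{0,\dots,\kappa-1\}$; $\mathcal A_\kappa^{\mathbb Z}$ carries the product topology and $\sigma(x)_n=x_{n+1}$ is the left shift. The noble means substitution with parameter $p$ is $\Gamma_{\mathrm{nm},p}:0\mapsto 0^p1,\ 1\mapsto 0$ (extended to words by concatenation). $X_{\mathrm{nm},p}$ is the set of all bi-infinite sequences $x\in\{0,1\}^{\mathbb Z}$ such that every finite word occurring in $x$ is a subword of $\Gamma_{\mathrm{nm},p}^n(0)$ for some $n\in\mathbb N$; since $\{0,1\}\subseteq\mathcal A_\kappa$ it is regarded as a subshift of $\mathcal A_\kappa^{\mathbb Z}$. For $\kappa,\ell\ge2$, $\eta_{\kappa,\ell}:\mathcal A_\kappa^{\mathbb Z}\to\mathcal A_\kappa^{\mathbb Z}$ is the sliding block code $\eta_{\kappa,\ell}(x)_n=x_{n+\ell-1}-x_n\bmod\kappa$. A system is strictly ergodic if it is minimal (all orbits are dense) and has exactly one shift-invariant Borel probability measure. *)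

(* Defs.v *)
From HB Require Import structures.
From mathcomp Require Import all_boot all_order all_algebra.
From mathcomp Require Import all_classical all_reals all_analysis.

Set Implicit Arguments.
Unset Strict Implicit.
Unset Printing Implicit Defensive.

Import Order.TTheory GRing.Theory Num.Theory.

Local Open Scope classical_set_scope.
Local Open Scope ring_scope.

HB.instance Definition _ (n : nat) := isPointed.Build 'I_n.+1 ord0.

(* The alphabet {0, ..., k-1} is encoded as 'Z_k, so that subtraction mod k is
   ring subtraction; this is only correct for 2 <= k. *)
Definition full_shift (k : nat) : Type :=
  prod_topology (fun _ : int => discrete_topology 'Z_k).

HB.instance Definition _ (k : nat) :=
  Pointed.copy (full_shift k) (int -> discrete_topology 'Z_k).
HB.instance Definition _ (k : nat) :=
  Topological.copy (full_shift k)
    (prod_topology (fun _ : int => discrete_topology 'Z_k)).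

Definition left_shift (k : nat) (x : full_shift k) : full_shift k :=
  fun n => x (n + 1).

(* The full orbit {left_shift^n x | n in Z}. *)
Definition shift_orbit (k : nat) (x : full_shift k) : set (full_shift k) :=
  [set ((fun m => x (m + n)) : full_shift k) | n in [set: int]].

Definition subshift (k : nat) (X : set (full_shift k)) : Prop :=
  closed X /\ @left_shift k @^-1` X = X.

Definition minimal (k : nat) (X : set (full_shift k)) : Prop :=
  forall x, X x -> X `<=` closure (shift_orbit x).

Definition borel (k : nat) := g_sigma_algebraType (@open (full_shift k)).

(* Shift-invariant Borel probability measures on a closed set X, seen as
   measures on the full shift giving X full mass: the library has no measurable
   structure on a subtype that may be empty. *)
Definition invariant_probability (R : realType) (k : nat)
    (X : set (full_shift k)) (mu : probability (borel k) R) : Prop :=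
  mu X = 1%E /\
  forall A : set (borel k), measurable A -> mu (@left_shift k @^-1` A) = mu A.

(* Uniqueness is on Borel sets: the values of a measure elsewhere are
   unconstrained. *)
Definition uniquely_ergodic (R : realType) (k : nat) (X : set (full_shift k))
    : Prop :=
  exists mu : probability (borel k) R, invariant_probability X mu /\
    forall nu : probability (borel k) R, invariant_probability X nu ->
      forall A : set (borel k), measurable A -> nu A = mu A.

Definition strictly_ergodic (R : realType) (k : nat) (X : set (full_shift k))
    : Prop :=
  [/\ subshift X, minimal X & uniquely_ergodic R X].

Definition nm_letter (p : nat) (a : 'Z_2) : seq 'Z_2 :=
  if a == 0 then rcons (nseq p 0) 1 else [:: 0].

Definition nm_subst (p : nat) (w : seq 'Z_2) : seq 'Z_2 :=
  flatten [seq nm_letter p a | a <- w].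

Definition X_nm (p : nat) : set (full_shift 2) :=
  [set x | forall (i : int) (m : nat), exists2 n : nat, (0 < n)%N &
     infix [seq x (i + j%:Z) | j <- iota 0 m] (iter n (nm_subst p) [:: 0])].

(* X_nm p inside the full shift on k letters, via {0,1} <= {0, ..., k-1}. *)
Definition X_nm_in (k p : nat) : set (full_shift k) :=
  [set ((fun n => (val (x n))%:R) : full_shift k) | x in X_nm p].

Arguments X_nm_in k p : clear implicits.

Definition eta (k l : nat) (x : full_shift k) : full_shift k :=
  fun n => (x (n + l%:Z - 1) : 'Z_k) - (x n : 'Z_k).

Arguments eta k l x _ : clear implicits.

(* Main.v *)
From HB Require Import structures.
From mathcomp Require Import measurable_realfun.
Require Import Defs.
From mathcomp Require Import all_boot all_order all_algebra.
From mathcomp Require Import all_classical all_reals all_analysis.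
From mathcomp Require Import zify ring lra.

(** The preimage of [X_nm] under [eta] is strictly ergodic because it is linearly
    recurrent: there is a constant [K] such that every word of length [n] occurs
    in every word of length [K * n] ([eta_preimage_linearly_recurrent]).

    A point [x] with [eta x = z] satisfies [x (n + l - 1) = x n + z n]; it is
    therefore described by [z] and a window of [l - 1] letters, and moving one
    step to the right applies a permutation, depending on the letter of [z], to
    the finite set of windows.  So the preimage is a finite extension of [X_nm],
    driven by an automaton whose letters act as permutations and, together,
    transitively.  Write [B n 0] for the n-th image of 0 under the substitution.
    Since [B n.+2 0 = (B n.+1 0)^p (B n 0)], two consecutive words [B n.+1 0] and
    [B n 0] generate, as permutations, the same group as the two letters do; the
    pair is always transitive.  Going down three levels in the hierarchy
    thus adds at least one new state in which the lower block is met, until all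
    states are exhausted ([card_visited]).  After a number of levels bounded by
    the number of states, a block contains the lower block in every state.
    Because block lengths grow at most by the factor [p + 1] per level, this is
    linear recurrence ([nm_linear_recurrence]).

    A nonempty linearly recurrent subshift is strictly ergodic
    ([linearly_recurrent_strictly_ergodic]).  Minimality is immediate.  For
    unique ergodicity, let [M] be the maximal asymptotic frequency of visits to a
    cylindrical set and [1 - M'] the minimal one.  A word with the minimal
    frequency occupies a proportion at least [1 / K] of every long word,
    including one with the maximal frequency; as the rest cannot exceed frequency
    [M], this forces [M <= 1 - M'] ([linearly_recurrent_frequency]).  Frequencies
    therefore exist uniformly.  They form an additive function of cylindrical
    sets, which compactness and the extension theorem turn into an invariant
    probability ([additive_extends]), and integrating the number of visits shows
    that every invariant probability takes these values
    ([invariant_probabilityE]). *)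

Set Implicit Arguments.
Unset Strict Implicit.
Unset Printing Implicit Defensive.

Import Order.TTheory GRing.Theory Num.Theory.

(** * Factors of concatenated blocks *)

Lemma infix_exists (T : eqType) (u w : seq T) :
  infix u w -> exists w1 w2, w = w1 ++ u ++ w2.
Proof. by move/infixP => [w1 [w2 ->]]; exists w1, w2. Qed.

Lemma infix_block_or_prefix_drop (T : eqType) (u v w : seq T) :
  infix u (v ++ w) ->
  infix u w \/ exists2 i, i < size v & prefix u (drop i v ++ w).
Proof.
move/infixP => [s1 [s2]] /(congr1 (drop (size s1))).
rewrite [RHS]drop_size_cat // drop_cat; case: ltnP => [lt_v eq_u | ge_v eq_u].
  by right; exists (size s1) => //; rewrite eq_u prefix_prefix.
left; apply/infixP; exists (take (size s1 - size v) w), s2.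
by rewrite -eq_u cat_take_drop.
Qed.

Lemma infix_drop_cat (T : eqType) i (v w : seq T) : infix (drop i v ++ w) (v ++ w).
Proof.
by rewrite -{2}(cat_take_drop i v) -catA suffixW ?suffix_suffix.
Qed.

Lemma infix_catl (T : eqType) (u v w : seq T) : infix u w -> infix u (v ++ w).
Proof.
move=> inf_u; apply: (@infix_trans _ w) => //.
by rewrite suffixW ?suffix_suffix.
Qed.

(** A word no longer than any block can straddle at most one boundary between
    consecutive blocks, so two blocks always suffice to contain it. *)
Lemma infix_flatten_short (T S : eqType) (f : S -> seq T) (w : seq S) u :
  (forall a, size u <= size (f a)) -> infix u (flatten [seq f a | a <- w]) ->
  exists2 v, infix v w & size v <= 2 /\ infix u (flatten [seq f a | a <- v]).
Proof.
move=> le_u; elim: w => [|a w IHw] /=.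
  by move=> inf_u; exists [::]; rewrite ?infix0s.
case/infix_block_or_prefix_drop => [/IHw [v inf_v [sz_v inf_u]] | [i lt_i pre_u]].
  by exists v; first exact: (@infix_catl _ _ [:: a]).
case: w {IHw} pre_u => [|b w] /= pre_u.
  exists [:: a]; first by rewrite eqxx.
  split=> //=.
  exact: (@infix_trans _ (drop i (f a) ++ [::])) (prefixW pre_u) (infix_drop_cat _ _ _).
exists [:: a; b]; first by rewrite !eqxx prefix0s.
split=> //=; rewrite cats0.
have {}pre_u : prefix u (drop i (f a) ++ f b).
  move: pre_u; rewrite !prefixE catA takel_cat // size_cat.
  by rewrite (leq_trans (le_u b)) ?leq_addl.
exact: (@infix_trans _ (drop i (f a) ++ f b)) (prefixW pre_u) (infix_drop_cat _ _ _).
Qed.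

(** An interval of length at least twice the maximal block length cannot lie
    inside two consecutive blocks, hence it covers some block completely. *)
Lemma infix_flatten_long (T S : eqType) (f : S -> seq T) (w : seq S) u B :
  0 < B -> (forall a, size (f a) <= B) -> 2 * B <= size u ->
  infix u (flatten [seq f a | a <- w]) -> exists a, infix (f a) u.
Proof.
move=> B0 leB sz_u; elim: w => [|a w IHw] /=.
  by move=> /eqP u0; rewrite u0 /= in sz_u; lia.
case/infix_block_or_prefix_drop => // -[i lt_i].
case: w {IHw} => [|b w] /=; move=> pre_u.
  have := size_prefix pre_u; rewrite cats0 size_drop; have := leB a; lia.
exists b; move/prefixP: pre_u => [t eq_u].
have := congr1 (take (size u)) eq_u.
rewrite [RHS]take_size_cat // take_cat size_drop.
have ha := leB a; have hb := leB b.
case: ifP => [|_ <-]; first by lia.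
rewrite take_cat; case: ifP => [|_]; first by lia.
exact/infix_catl/prefixW/prefix_prefix.
Qed.

(** * Noble means words *)

Definition nm_block p n (a : 'Z_2) : seq 'Z_2 := iter n (nm_subst p) [:: a].

Arguments nm_block : simpl never.

Lemma Z2_cases (a : 'Z_2) : a = 0%R \/ a = 1%R.
Proof. by case: a => [[|[|//]] i]; [left|right]; apply/val_inj. Qed.

Lemma nm_subst_cat p u v : nm_subst p (u ++ v) = nm_subst p u ++ nm_subst p v.
Proof. by rewrite /nm_subst map_cat flatten_cat. Qed.

Lemma iter_nm_subst_cat p n u v :
  iter n (nm_subst p) (u ++ v) = iter n (nm_subst p) u ++ iter n (nm_subst p) v.
Proof. by elim: n => //= n ->; rewrite nm_subst_cat. Qed.

Lemma iter_nm_subst p n w :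
  iter n (nm_subst p) w = flatten [seq nm_block p n a | a <- w].
Proof.
elim: w => [|a w IHw] /=; first by elim: n => //= n ->.
by rewrite -cat1s iter_nm_subst_cat IHw.
Qed.

Lemma nm_block0S p n :
  nm_block p n.+1 0%R = flatten (nseq p (nm_block p n 0%R)) ++ nm_block p n 1%R.
Proof.
rewrite /nm_block iterSr [nm_subst p _]cats0 /nm_letter eqxx -cats1 iter_nm_subst_cat.
by rewrite iter_nm_subst map_nseq.
Qed.

Lemma nm_block1S p n : nm_block p n.+1 1%R = nm_block p n 0%R.
Proof. by rewrite /nm_block iterSr. Qed.

Section NobleMeans.
Context (p : nat) (p_gt0 : 0 < p).
Local Notation B := (nm_block p).

Lemma nm_block_prefix n : exists w, B n.+1 0%R = B n 0%R ++ w.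
Proof.
case: p p_gt0 => // q _; rewrite nm_block0S /= -catA.
by eexists.
Qed.

(** For [1 < p] the word [B n.+2 0] starts with the square of [B n.+1 0], for
    [p = 1] it is [B n.+1 0 ++ B n 0]; in both cases [B n 0] can be read right
    after the first [B n.+1 0]. *)
Lemma nm_block_prefix2 n : exists w, B n.+2 0%R = B n.+1 0%R ++ B n 0%R ++ w.
Proof.
have [v eqv] := nm_block_prefix n.
have {v eqv} [v eqv] : exists v, flatten (nseq p.-1 (B n.+1 0%R)) ++ B n 0%R = B n 0%R ++ v.
  case: p.-1 => [|q] /=; first by exists [::]; rewrite cats0.
  by rewrite {1}eqv -!catA; eexists.
exists v; rewrite -eqv nm_block0S nm_block1S.
by case: p p_gt0 => // q _; rewrite /= -catA.
Qed.

Lemma size_nm_block0S n :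
  size (B n.+1 0%R) = p * size (B n 0%R) + size (B n 1%R).
Proof.
by rewrite nm_block0S size_cat size_flatten /shape map_nseq sumn_nseq mulnC.
Qed.

Lemma size_nm_block_gt0 n a : 0 < size (B n a).
Proof.
elim: n a => // n IHn a; have [->|->] := Z2_cases a; last by rewrite nm_block1S.
by rewrite size_nm_block0S addn_gt0 IHn orbT.
Qed.

Lemma size_nm_block0_gtn n : n < size (B n 0%R).
Proof.
elim: n => // n IHn; rewrite size_nm_block0S.
have := size_nm_block_gt0 n 1%R; have := leq_pmull (size (B n 0%R)) p_gt0; lia.
Qed.

Lemma size_nm_block1_le n : size (B n 1%R) <= size (B n 0%R).
Proof.
case: n => // n; rewrite nm_block1S size_nm_block0S.
by apply: leq_trans (leq_addr _ _); rewrite leq_pmull.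
Qed.

Lemma size_nm_blockS n a : size (B n.+1 a) <= p.+1 * size (B n a).
Proof.
have [->|->] := Z2_cases a; last first.
  rewrite nm_block1S; case: n => [|n]; first by rewrite /= muln1.
  rewrite nm_block1S size_nm_block0S mulSn addnC.
  by rewrite leq_add2r size_nm_block1_le.
by rewrite size_nm_block0S mulSn addnC leq_add2r size_nm_block1_le.
Qed.

Lemma size_nm_block_add m n a : size (B (n + m) a) <= p.+1 ^ m * size (B n a).
Proof.
elim: m => [|m IHm]; first by rewrite addn0 mul1n.
rewrite addnS expnS; apply: leq_trans (size_nm_blockS _ _) _.
by rewrite -mulnA leq_mul2l IHm orbT.
Qed.

Lemma nm_block_prefix_le m n : m <= n -> prefix (B m 0%R) (B n 0%R).
Proof.
move/subnK <-; elim: (n - m) => [|d IHd]; first exact: prefix_refl.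
have [w ->] := nm_block_prefix (d + m).
exact: (@prefix_trans _ (B (d + m) 0%R)) IHd (prefix_prefix _ _).
Qed.

Lemma nm_block0_prefixS n a : prefix (B n 0%R) (B n.+1 a).
Proof.
have [->|->] := Z2_cases a; first exact: nm_block_prefix_le.
by rewrite nm_block1S prefix_refl.
Qed.

Lemma size_nm_block_le0 n a : size (B n a) <= size (B n 0%R).
Proof. by have [->|->] := Z2_cases a; rewrite ?size_nm_block1_le. Qed.

Lemma size_nm_block_ge1 n a : size (B n 1%R) <= size (B n a).
Proof. by have [->|->] := Z2_cases a; rewrite ?size_nm_block1_le. Qed.

Lemma nm_blockD m n :
  B (m + n) 0%R = flatten [seq B m a | a <- B n 0%R].
Proof. by rewrite -iter_nm_subst /nm_block iterD. Qed.

(** The binary words of length at most two form a finite list, and the blocks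
    [B j 0] increase for the prefix order, so one [s] serves all of them. *)
Lemma nm_short_factors : exists s, forall v j,
  size v <= 2 -> infix v (B j 0%R) -> infix v (B s 0%R).
Proof.
have fin (vs : seq (seq 'Z_2)) : exists s, forall v j,
    v \in vs -> infix v (B j 0%R) -> infix v (B s 0%R).
  elim: vs => [|v vs [s IHs]]; first by exists 0.
  have [[j inf_v]|no_v] := pselect (exists j, infix v (B j 0%R)).
    exists (maxn s j) => v' j'; rewrite inE => /orP[/eqP-> _ | /IHs h /h {}h].
      by apply: (infix_trans inf_v); rewrite prefixW ?nm_block_prefix_le ?leq_maxr.
    by apply: (infix_trans h); rewrite prefixW ?nm_block_prefix_le ?leq_maxl.
  exists s => v' j'; rewrite inE => /orP[/eqP-> inf_v | /IHs]; last exact.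
  by case: no_v; exists j'.
have [s hs] := fin ([::] :: [seq [:: a] | a <- enum 'Z_2] ++
                    [seq [:: a; b] | a <- enum 'Z_2, b <- enum 'Z_2]).
exists s => v j sz_v; apply: hs; rewrite inE mem_cat.
case: v sz_v => [|a [|b [|//]]] _ //=; apply/orP; [left|right].
  by apply/mapP; exists a; rewrite ?mem_enum.
by apply/allpairsP; exists (a, b); rewrite !mem_enum.
Qed.

(** A factor that is not longer than the level [m] blocks is covered by the
    image of a factor [v] of length at most two; the level [s] that exhibits all
    such [v] depends neither on [m] nor on the factor. *)
Lemma nm_factor_short : exists s, forall m n u,
  size u <= size (B m 1%R) -> infix u (B n 0%R) -> infix u (B (m + s) 0%R).
Proof.
have [s hs] := nm_short_factors; exists s => m n u sz_u.
case: (leqP m n) => [/subnKC <- | lt_nm]; last first.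
  move=> inf_u; apply: (infix_trans inf_u); apply/prefixW/nm_block_prefix_le => //.
  exact: leq_trans (ltnW lt_nm) (leq_addr _ _).
rewrite nm_blockD => /infix_flatten_short[a | v inf_v [sz_v inf_u]].
  exact: leq_trans (size_nm_block_ge1 _ _).
apply: (infix_trans inf_u); rewrite nm_blockD.
have /infix_exists[w1 [w2 ->]] := hs _ _ sz_v inf_v.
by rewrite !map_cat !flatten_cat; apply/infixP; eexists; eexists.
Qed.

(** Cut the level [n] block into blocks of level [m.+1]: both kinds of them
    begin with [B m 0], and a long factor contains one of them entirely. *)
Lemma nm_factor_long m n u :
  2 * size (B m.+1 0%R) <= size u -> infix u (B n 0%R) -> infix (B m 0%R) u.
Proof.
move=> sz_u; case: (leqP m.+1 n) => [/subnKC <- | lt_nm] inf_u; last first.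
  have pre_n : prefix (B n 0%R) (B m.+1 0%R) by apply: nm_block_prefix_le; lia.
  have := leq_trans (leq_trans sz_u (size_infix inf_u)) (size_prefix pre_n).
  have := size_nm_block_gt0 m.+1 0%R.
  by move: (size (B m.+1 0%R)) => k *; exfalso; lia.
move: inf_u; rewrite nm_blockD => inf_u.
have [a inf_a] :=
  infix_flatten_long (size_nm_block_gt0 _ _) (size_nm_block_le0 _) sz_u inf_u.
exact: infix_trans (prefixW (nm_block0_prefixS _ _)) inf_a.
Qed.
End NobleMeans.

(** * Noble means words read by a finite permutation automaton *)

Section Automaton.
Context (p : nat) (p_gt0 : 0 < p).
Context (C : finType) (step : C -> 'Z_2 -> C).
Context (step_inj : forall a, injective (step ^~ a)).
Context (step_transitive : forall A : {set C},
  (exists c, c \in A) -> (forall c a, (step c a \in A) = (c \in A)) -> A = [set: C]).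

Local Notation B := (nm_block p).

(** A word acts on the finite set [C] of states of a permutation automaton; this
    is the cocycle of a finite group extension of the shift. *)
Definition read (c : C) (w : seq 'Z_2) : C := foldl step c w.

Lemma read_cat c u v : read c (u ++ v) = read (read c u) v.
Proof. exact: foldl_cat. Qed.

Lemma read_inj w : injective (read ^~ w).
Proof. by elim: w => [|a w IHw] c c' //= /IHw/step_inj. Qed.

Lemma read_surj w c : exists c', read c' w = c.
Proof.
by have [g _ gK] := injF_bij (@read_inj w); exists (g c); rewrite gK.
Qed.

(** Words of the extension are pairs of an initial state and a word; this is the
    factor relation between them. *)
Definition occurs (c' : C) (u : seq 'Z_2) (c : C) (w : seq 'Z_2) : Prop :=
  exists w1 w2, w = w1 ++ u ++ w2 /\ read c w1 = c'.

Lemma occurs_trans c' u c w c'' v :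
  occurs c'' v c' u -> occurs c' u c w -> occurs c'' v c w.
Proof.
move=> [u1 [u2 [-> <-]]] [w1 [w2 [-> <-]]]; exists (w1 ++ u1), (u2 ++ w2).
by rewrite read_cat -!catA.
Qed.

Lemma occurs_prefix c u w : occurs c u c (u ++ w).
Proof. by exists [::], w. Qed.

Lemma occurs_after c u v w : occurs (read c v) u c (v ++ u ++ w).
Proof. by exists v, w. Qed.

Lemma infix_occurs c' u w : infix u w -> exists c, occurs c' u c w.
Proof.
move/infix_exists => [w1 [w2 ->]]; have [c <-] := read_surj w1 c'.
by exists c, w1, w2.
Qed.

Definition invariant_under (A : {set C}) w := forall c, (read c w \in A) = (c \in A).

(** A permutation that maps a finite set into itself permutes it, so invariance
    in one direction gives it in both. *)
Lemma invariant_under_closed (A : {set C}) w :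
  (forall c, c \in A -> read c w \in A) -> invariant_under A w.
Proof.
move=> Aw; have imA : [set read c w | c in A] = A.
  apply/eqP; rewrite eqEcard card_imset ?leqnn ?andbT; last exact: read_inj.
  by apply/fintype.subsetP => _ /imsetP[c /Aw ? ->].
move=> c; apply/idP/idP => [|/Aw//]; rewrite -{1}imA.
by case/imsetP => c' Ac' /read_inj->.
Qed.

Lemma invariant_under_catl (A : {set C}) u v :
  invariant_under A u -> invariant_under A (u ++ v) -> invariant_under A v.
Proof.
move=> Au Auv c; have [c' <-] := read_surj u c.
by rewrite -read_cat Auv Au.
Qed.

(** The substitution induces an invertible change of generators: [B n 0] and
    [B n 1] are recovered from [B n.+1 1 = B n 0] and
    [B n.+1 0 = (B n 0)^p (B n 1)] by cancelling on the left.  Invariance thus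
    descends from level [n] to the letters. *)
Lemma invariant_under_blocks (A : {set C}) n :
  invariant_under A (B n 0%R) -> invariant_under A (B n 1%R) ->
  forall a, invariant_under A [:: a].
Proof.
elim: n => [|n IHn] A0 A1 a; first by have [->|->] := Z2_cases a.
rewrite nm_block1S in A1; apply: IHn => //.
apply: (@invariant_under_catl _ (flatten (nseq p (B n 0%R)))); last first.
  by rewrite -nm_block0S.
move: (p in nseq p _) => q.
by elim: q => [|q IHq] c //=; rewrite read_cat IHq A1.
Qed.

Lemma invariant_under_setT (A : {set C}) n c : c \in A ->
  invariant_under A (B n.+1 0%R) -> invariant_under A (B n 0%R) -> A = [set: C].
Proof.
move=> Ac A1 A0; apply: step_transitive => [|c' a]; first by exists c.
have := invariant_under_blocks A1 _ a c'; apply; rewrite nm_block1S.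
exact: A0.
Qed.

Definition visited m n c : {set C} :=
  [set c' | `[< occurs c' (B m 0%R) c (B n 0%R) >]].

Lemma visitedP m n c c' :
  reflect (occurs c' (B m 0%R) c (B n 0%R)) (c' \in visited m n c).
Proof. by rewrite inE; apply: asboolP. Qed.

(** Let [A] be the states in which [B m.+3 0] is met.  Each occurrence of
    [B m.+3 0] in state [d] contains occurrences of [B m 0] in the states [d],
    [read d (B m.+1 0)] and [read d (B m.+2 0)].  Unless [A] is full, it is not
    invariant under both words, because they act transitively together; so
    going down three levels meets at least one new state. *)
Lemma card_visited m j c : minn j.+1 #|C| <= #|visited m (m + 3 * j) c|.
Proof.
elim: j m => [|j IHj] m.
  have : c \in visited m (m + 3 * 0) c.
    by apply/visitedP; rewrite addn0 -{2}(cats0 (B m 0%R)); exact: occurs_prefix.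
  by rewrite (cardD1 c) => ->; rewrite geq_min.
have := IHj m.+3; set A := visited _ _ _ => leA.
have -> : m + 3 * j.+1 = m.+3 + 3 * j by lia.
set A' := visited m _ _.
have [w1 e1] := nm_block_prefix p_gt0 m.
have [w2 e2] := nm_block_prefix2 p_gt0 m.
have [w3 e3] := nm_block_prefix2 p_gt0 m.+1.
have occ0 d : occurs d (B m 0%R) d (B m.+3 0%R).
  by rewrite e3 e2 e1 -!catA; exact: occurs_prefix.
have occ1 d : occurs (read d (B m.+1 0%R)) (B m 0%R) d (B m.+3 0%R).
  by rewrite e3 e2 -!catA; exact: occurs_after.
have occ2 d : occurs (read d (B m.+2 0%R)) (B m 0%R) d (B m.+3 0%R).
  by rewrite e3 e1 -!catA; exact: occurs_after.
have sub (f : C -> C) : (forall d, occurs (f d) (B m 0%R) d (B m.+3 0%R)) ->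
    forall d, d \in A -> f d \in A'.
  by move=> occf d /visitedP Ad; apply/visitedP; exact: occurs_trans (occf d) Ad.
have subA : A \subset A' by apply/fintype.subsetP; exact: (sub id).
have [eqA|neqA] := eqVneq A [set: C].
  by move: subA; rewrite eqA => /subset_leq_card; rewrite cardsT; lia.
suff : #|A| < #|A'|.
  by move: leA; move: #|A| #|A'| #|C| => x y z; lia.
apply: proper_card; rewrite finset.properEneq subA andbT; apply: contra neqA => /eqP eqA.
have [d Ad] : exists d, d \in A.
  apply/finset.set0Pn; rewrite -card_gt0; apply: leq_trans leA.
  by rewrite leq_min /=; apply/card_gt0P; exists c.
apply/eqP/(@invariant_under_setT _ m.+1 d Ad); apply: invariant_under_closed.
  by move=> e Ae; rewrite eqA; exact: (sub (read ^~ _)).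
by move=> e Ae; rewrite eqA; exact: (sub (read ^~ _)).
Qed.

Lemma occurs_block m c c' : occurs c' (B m 0%R) c (B (m + 3 * #|C|) 0%R).
Proof.
apply/visitedP; suff -> : visited m (m + 3 * #|C|) c = [set: C] by rewrite inE.
apply/eqP; rewrite eqEcard finset.subsetT cardsT.
by apply: leq_trans (card_visited _ _ _); rewrite leq_min leqnSn leqnn.
Qed.

Definition nm_factor (u : seq 'Z_2) := exists n, infix u (B n 0%R).

(** A factor [u] of length [n] lies in [B (m + s) 0] for the least [m] with
    [n <= size (B m 1)].  Put in the appropriate state, this block occurs in
    [B M 0] whatever the initial state, and every factor of length
    [2 * size (B M.+1 0)] contains [B M 0].  As [M - m] does not depend on [n]
    and [m] is minimal, that length is at most a constant times [n]. *)
Lemma nm_linear_recurrence : exists K, forall n u v c c', 0 < n ->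
  size u = n -> size v = K * n -> nm_factor u -> nm_factor v -> occurs c' u c v.
Proof.
have [s hs] := nm_factor_short p_gt0.
exists (2 * p.+1 ^ (s + 3 * #|C| + 3)) => n u v c c' n_gt0 sz_u sz_v [ju inf_u] [jv inf_v].
have [m le_m min_m] : exists2 m, n <= size (B m 1%R) &
    forall m', n <= size (B m' 1%R) -> m <= m'.
  have ex_m : exists m, n <= size (B m 1%R).
    by exists n.+1; rewrite nm_block1S; apply/ltnW/size_nm_block0_gtn.
  by exists (ex_minn ex_m); case: ex_minnP.
have inf_u' : infix u (B (m + s) 0%R) by apply: (hs _ ju); rewrite ?sz_u.
set M := m + s + 3 * #|C|.
have inf_M : infix (B M 0%R) v.
  apply: (nm_factor_long p_gt0 _ inf_v); rewrite sz_v -mulnA leq_mul2l /=.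
  rewrite -nm_block1S.
  (* minimality bounds the block one level below [m] by [n], except at [m = 0] *)
  case: m @M le_m min_m {inf_u'} => [|m] M le_m min_m.
    have -> : M.+2 = 0 + M.+2 by [].
    apply: leq_trans (size_nm_block_add p_gt0 _ _ _) _; rewrite leq_mul //.
    by rewrite leq_exp2l // /M add0n addn3.
  have -> : M.+2 = m + (s + 3 * #|C| + 3) by rewrite /M; lia.
  apply: leq_trans (size_nm_block_add p_gt0 _ _ _) _; rewrite leq_mul2l.
  apply/orP; right; rewrite leqNgt; apply/negP => lt_n.
  by have := min_m m (ltnW lt_n); rewrite ltnn.
have [c1 occ1] := infix_occurs c' inf_u'.
have /infix_exists[v1 [v2 eq_v]] := inf_M.
apply: (occurs_trans occ1); apply: (occurs_trans (occurs_block _ (read c v1) _)).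
by rewrite eq_v; exact: occurs_after.
Qed.
End Automaton.

(** * The preimage under eta *)

(** Words are taken as windows of points, so that the notion makes sense for any
    set of bi-infinite sequences, without a language. *)
Definition linearly_recurrent k (X : set (full_shift k)) : Prop :=
  exists K, forall n (x x' : full_shift k) (i t : int), 0 < n -> X x -> X x' ->
    exists2 j, j + n <= K * n &
      forall s, s < n -> x' (i + s%:Z)%R = x (t + j%:Z + s%:Z)%R.

Section Preimage.
Context (k L : nat).
Local Notation state := (L.+1.-tuple 'Z_k).

(** A point [x] of the preimage of [z] is determined by [z] and the window of
    length [L.+1] at the origin, since [x (n + L.+1) = x n + z n].  Sliding the
    window by one step is [push]. *)
Definition push (c : state) (b : 'Z_k) : state :=
  [tuple of rcons (behead c) (thead c + b)%R].

Definition eta_step (c : state) (a : 'Z_2) : state := push c (val a)%:R%R.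

Lemma push_inj b : injective (push ^~ b).
Proof.
case/tupleP=> x c; case/tupleP=> y d /(congr1 val)/rcons_inj e.
have /= eq_cd := congr1 fst e; have /= := congr1 snd e; rewrite !theadE.
by move=> /addIr eq_xy; apply/val_inj; rewrite /= eq_xy eq_cd.
Qed.

Lemma eta_step_inj a : injective (eta_step ^~ a).
Proof. exact: push_inj. Qed.

(** Letters 0 and 1 give [push c 0] and [push c 1], hence an invariant set is
    invariant under every [push c b]; and [L.+1] pushes with suitable letters
    replace all entries of a window by prescribed ones. *)
Lemma eta_step_transitive (A : {set state}) :
  (exists c, c \in A) -> (forall c a, (eta_step c a \in A) = (c \in A)) ->
  A = [set: state].
Proof.
move=> [c0 Ac0] inv_step.
have inv b c : (push c b \in A) = (c \in A).
  rewrite -(natr_Zp b); move: (val b) => j; elim: j c => [|j IHj] c.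
    exact: (inv_step c 0%R).
  pose d : state := [tuple of (thead c + j%:R)%R :: behead c].
  have push_d a : push d a = push c (j%:R + a)%R.
    by apply: val_inj; rewrite /= theadE addrA.
  rewrite mulrSr -push_d -[1%R]/(1%:R)%R (inv_step d 1%R) -(inv_step d 0%R).
  by rewrite /eta_step push_d addr0.
have reach (s u t : seq 'Z_k) : size s = size u ->
    (exists2 c, c \in A & val c = u ++ t) -> exists2 c, c \in A & val c = t ++ s.
  elim: s u t => [|b s IHs] [|a u] t //=; first by rewrite cats0.
  move=> [sz_s] [c Ac eq_c]; rewrite -cat_rcons; apply: (IHs u) => //.
  exists (push c (b - a)%R); first by rewrite inv.
  rewrite /= eq_c /= rcons_cat; congr (_ ++ rcons _ _).
  by rewrite /thead (tnth_nth 0%R) /= eq_c /= addrC subrK.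
apply/setP => c; rewrite inE.
have [|d Ad eq_d] := reach (val c) (val c0) [::] (etrans (size_tuple _) (esym (size_tuple _))).
  by exists c0; rewrite ?cats0.
by rewrite (_ : c = d) //; apply: val_inj.
Qed.

Definition window_state (x : full_shift k) (n : int) : state :=
  [tuple x (n + i%:Z)%R | i < L.+1].

Definition word (z : full_shift 2) (i : int) m : seq 'Z_2 :=
  [seq z (i + j%:Z)%R | j <- iota 0 m].

Lemma wordD z i m n : word z i (m + n) = word z i m ++ word z (i + m%:Z)%R n.
Proof.
rewrite /word iotaD map_cat add0n; congr (_ ++ _).
rewrite -{1}(addn0 m) iotaDl -map_comp; apply: eq_map => j /=.
by rewrite PoszD addrA.
Qed.

Lemma size_word z i m : size (word z i m) = m.
Proof. by rewrite size_map size_iota. Qed.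

Definition codes (z : full_shift 2) (x : full_shift k) : Prop :=
  forall n, eta k L.+2 x n = ((val (z n))%:R : 'Z_k)%R.

Lemma codesE z x n : codes z x ->
  x (n + L.+1%:Z)%R = (x n + (val (z n))%:R :> 'Z_k)%R.
Proof.
move/(_ n) <-; rewrite /eta [RHS]addrC subrK; congr (x _); lia.
Qed.

Lemma nth_window_state x n i :
  i < L.+1 -> nth 0%R (window_state x n) i = x (n + i%:Z)%R.
Proof.
by move=> lt_i; have := tnth_mktuple (fun i : 'I_L.+1 => x (n + i%:Z)%R)
  (Ordinal lt_i); rewrite (tnth_nth 0%R).
Qed.

Lemma window_state_head x n : thead (window_state x n) = x n.
Proof. by rewrite /thead tnth_mktuple /= addr0. Qed.

Lemma window_stateS z x n : codes z x ->
  window_state x (n + 1)%R = eta_step (window_state x n) (z n).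
Proof.
move=> zx; apply: val_inj; apply: (@eq_from_nth _ 0%R); first by rewrite !size_tuple.
move=> i; rewrite size_tuple => lt_i; rewrite nth_window_state //.
rewrite nth_rcons size_behead size_tuple nth_behead /=.
rewrite ltnS in lt_i; case: ltngtP lt_i => // [lt_i _|-> _].
  by rewrite nth_window_state //; congr (x _); lia.
rewrite window_state_head -codesE //; congr (x _); lia.
Qed.

Lemma window_stateD z x n m : codes z x ->
  window_state x (n + m%:Z)%R = read eta_step (window_state x n) (word z n m).
Proof.
move=> zx; elim: m => [|m IHm]; first by rewrite addr0.
rewrite -(addn1 m) PoszD addrA (window_stateS _ zx) IHm wordD read_cat /=.
by rewrite /read /= addr0.
Qed.

Lemma mem_eta_preimage p x :
  (eta k L.+2 @^-1` X_nm_in k p)%classic x <-> exists2 z, X_nm p z & codes z x.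
Proof.
split=> [[z Xz eq_z]|[z Xz zx]]; exists z => //.
  by move=> n; rewrite -eq_z.
by apply/funext => n; rewrite zx.
Qed.

Lemma X_nm_factor p z i m : X_nm p z -> nm_factor p (word z i m).
Proof. by move=> /(_ i m)[n _ inf_n]; exists n. Qed.

(** If the same word of [z] is read from the same window of [x], then the same
    letters of [x] are produced; so this is linear recurrence of the noble means
    words with the windows as states of the automaton. *)
Lemma eta_preimage_linearly_recurrent p : 0 < p ->
  linearly_recurrent (eta k L.+2 @^-1` X_nm_in k p)%classic.
Proof.
move=> p_gt0; have [K hK] := nm_linear_recurrence p_gt0 eta_step_inj eta_step_transitive.
exists K => n x x' i t n_gt0 /mem_eta_preimage[z Xz zx] /mem_eta_preimage[z' Xz' zx'].
have [w1 [w2 [eq_w eq_s]]] := hK n (word z' i n) (word z t (K * n))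
  (window_state x t) (window_state x' i) n_gt0 (size_word _ _ _) (size_word _ _ _)
  (X_nm_factor _ _ Xz') (X_nm_factor _ _ Xz).
have sz_w := congr1 size eq_w; rewrite !size_cat !size_word in sz_w.
have le_K : size w1 + n <= K * n by lia.
exists (size w1) => // s lt_s.
move: eq_w; have -> : K * n = size w1 + (n + (K * n - size w1 - n)) by lia.
rewrite !wordD => /eqP; rewrite eqseq_cat ?size_word // => /andP[/eqP eq1].
rewrite eqseq_cat ?size_word // => /andP[/eqP eq2 _].
rewrite -(window_state_head x) -(window_state_head x').
rewrite (window_stateD _ _ zx') (window_stateD _ _ zx) (window_stateD _ _ zx) eq1 eq_s.
move: eq2; rewrite -(subnKC (ltnW lt_s)) !wordD => /eqP.
by rewrite eqseq_cat ?size_word // => /andP[/eqP -> _].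
Qed.

End Preimage.

Local Open Scope classical_set_scope.

(** * Windows and the topology of the full shift *)

Lemma nbhs_prod_coord (I : eqType) (K : I -> discreteTopologicalType)
  (x : prod_topology K) i : nbhs x [set y : prod_topology K | x i = y i].
Proof.
have /(_ [set x i]) := @proj_continuous I K i x.
move=> /(_ (discrete_set1 _)) h.
by apply: (@filterS _ (nbhs x) _ _ _ _ h) => y <-.
Qed.

Section Windows.
Context (k : nat).
Local Notation shift := (full_shift k).
Implicit Types (x y : shift) (A B : set shift).

Definition agree n x y : Prop := forall i : int, `|i|%N <= n -> x i = y i.

Lemma agree_refl n x : agree n x x. Proof. by []. Qed.

Lemma agree_sym n x y : agree n x y -> agree n y x.
Proof. by move=> xy i /xy. Qed.

Lemma agree_trans n x y z : agree n x y -> agree n y z -> agree n x z.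
Proof. by move=> xy yz i le_i; rewrite xy // yz. Qed.

Lemma agree_le m n x y : m <= n -> agree n x y -> agree m x y.
Proof. by move=> le_mn xy i le_i; apply: xy; exact: leq_trans le_mn. Qed.

Lemma nbhs_coord x (i : int) : nbhs x [set y : shift | x i = y i].
Proof. exact: (@nbhs_prod_coord int (fun=> discrete_topology 'Z_k)). Qed.

Lemma nbhs_agree n x : nbhs x [set y | agree n x y].
Proof.
elim: n => [|n IHn].
  by apply: filterS (nbhs_coord x 0%R) => y xy i; rewrite leqn0 absz_eq0 => /eqP->.
apply: filterS (filterI IHn (filterI (nbhs_coord x n.+1%:Z%R) (nbhs_coord x (- n.+1%:Z)%R))).
move=> y [xy [/= xn xNn]] i le_i.
have [le_n|lt_n] := leqP `|i| n; first exact: xy.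
have [->//|->//] : i = n.+1%:Z%R \/ i = (- n.+1%:Z)%R by lia.
Qed.

(** Otherwise there would be points [g n] outside [A] agreeing with [x] on
    [[-n, n]]; they converge to [x] pointwise, that is, in the product topology. *)
Lemma agree_nbhs x A : nbhs x A -> exists n, forall y, agree n x y -> A y.
Proof.
move=> nA; apply: contrapT => no_n.
have /choice [g hg] n : exists y, agree n x y /\ ~ A y.
  apply: contrapT => no_y; apply: no_n; exists n => y xy.
  by apply: contrapT => nAy; apply: no_y; exists y.
suff /(_ _ nA) : g @ \oo --> (x : shift).
  by rewrite nbhs_simpl => -[N _ /(_ N (leqnn _))]; have [] := hg N.
apply/cvg_sup => i U [V] [[W] oW <-] WfN WU.
apply: (filterS WU); rewrite nbhs_simpl; exists `|i|%N => // n /= le_n.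
by rewrite -(hg n).1.
Qed.

Definition window n A := forall x y, agree n x y -> A x -> A y.
Definition cylindrical A := exists n, window n A.

Lemma window_le m n A : m <= n -> window m A -> window n A.
Proof. by move=> le_mn wA x y /(agree_le le_mn); exact: wA. Qed.

Lemma windowC n A : window n A -> window n (~` A).
Proof. by move=> wA x y xy nAx Ay; apply/nAx/(wA _ _ _ Ay)/agree_sym. Qed.

Lemma windowU n A B : window n A -> window n B -> window n (A `|` B).
Proof. by move=> wA wB x y xy [/(wA _ _ xy)|/(wB _ _ xy)]; [left|right]. Qed.

Lemma cylindrical0 : cylindrical set0.
Proof. by exists 0. Qed.

Lemma cylindricalC A : cylindrical A -> cylindrical (~` A).
Proof. by move=> [n wA]; exists n; exact: windowC. Qed.

Lemma cylindricalU A B : cylindrical A -> cylindrical B -> cylindrical (A `|` B).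
Proof.
move=> [m wA] [n wB]; exists (maxn m n); apply: windowU.
  exact: window_le (leq_maxl _ _) wA.
exact: window_le (leq_maxr _ _) wB.
Qed.

Lemma cylindrical_open A : cylindrical A -> open A.
Proof.
move=> [n wA]; rewrite openE => x Ax; apply: filterS (nbhs_agree n x).
by move=> y /wA; apply.
Qed.

Lemma cylindrical_closed A : cylindrical A -> closed A.
Proof.
by move=> cA; rewrite -[A]setCK; apply/open_closedC/cylindrical_open/cylindricalC.
Qed.

Lemma closed_agree A :
  (forall x, (forall n, exists2 y, A y & agree n x y) -> A x) -> closed A.
Proof.
move=> hA x clAx; apply: hA => n.
by have [y [Ay xy]] := clAx _ (nbhs_agree n x); exists y.
Qed.

Lemma full_shift_compact : compact [set: shift].
Proof.
have := @tychonoff int (fun=> discrete_topology 'Z_k) (fun=> setT).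
have -> : [set f : forall i : int, discrete_topology 'Z_k | forall i, setT (f i)] = setT.
  by apply/seteqP; split.
apply=> i; apply: finite_compact; exact: finite_finset.
Qed.

(** Compactness of the full shift makes countable additivity on cylindrical sets
    a finite statement. *)
Lemma cylindrical_finite_cover A (F : nat -> set shift) :
  cylindrical A -> (forall n, cylindrical (F n)) -> A `<=` \bigcup_n F n ->
  exists N, A `<=` \bigcup_(n < N) F n.
Proof.
move=> cA cF AF.
have : compact A.
  exact: (subclosed_compact (cylindrical_closed cA) full_shift_compact).
rewrite compact_cover => /(_ nat setT F) [|//|D _ AD].
  by move=> n _; exact/cylindrical_open.
exists (\max_(i <- finmap.enum_fset D) i).+1 => x /AD[n Dn Fnx]; exists n => //=.
by rewrite ltnS; exact: leq_bigmax_seq.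
Qed.

Lemma open_bigcup_window A : open A ->
  A = \bigcup_n [set x | forall y, agree n x y -> A y].
Proof.
move=> oA; apply/seteqP; split=> [x Ax|x [n _]]; last by apply.
by have [n hn] := agree_nbhs (open_nbhs_nbhs (conj oA Ax)); exists n.
Qed.

Lemma window_interior n A : window n [set x | forall y, agree n x y -> A y].
Proof. by move=> x y xy hx z /(agree_trans xy); exact: hx. Qed.

(** An open set is a countable union of window sets, its interiors for the
    windows [[-n, n]], so cylindrical sets generate the Borel sets. *)
Lemma sigma_cylindrical : <<s cylindrical >> = <<s @open shift >>.
Proof.
apply/seteqP; split; last first.
  apply: smallest_sub; first exact: smallest_sigma_algebra.
  move=> A /open_bigcup_window ->.
  apply: sigma_algebra_bigcup => n; apply: sub_sigma_algebra.
  by exists n; exact: window_interior.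
by apply: sub_smallest2r; [exact: smallest_sigma_algebra|]; exact: cylindrical_open.
Qed.
End Windows.

(** * Uniform frequencies in linearly recurrent subshifts *)

Section Visits.
Local Open Scope ring_scope.
Context (k : nat).
Local Notation shift := (full_shift k).
Implicit Types (x y : shift) (A B : set shift).

Definition translate x (m : int) : shift := fun n => x (n + m).

Definition visits A N x : nat := (\sum_(i < N) `[< A (translate x i%:Z) >])%N.

Lemma translateD x m n : translate (translate x m) n = translate x (m + n).
Proof. by apply/funext => i; rewrite /translate addrA addrAC. Qed.

Lemma left_shiftE x : left_shift x = translate x 1.
Proof. by []. Qed.

Lemma visitsD A M N x :
  visits A (M + N) x = (visits A M x + visits A N (translate x M%:Z))%N.
Proof.
rewrite /visits big_split_ord /=; congr (_ + _)%N.
by apply: eq_bigr => i _; rewrite translateD PoszD.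
Qed.

Lemma visits_le A N x : (visits A N x <= N)%N.
Proof.
rewrite -[leqRHS]card_ord -sum1_card; apply: leq_sum => i _; exact: leq_b1.
Qed.

Lemma visitsC A N x : (visits A N x + visits (~` A) N x)%N = N.
Proof.
rewrite -big_split /= -[RHS]card_ord -sum1_card; apply: eq_bigr => i _.
by rewrite asbool_neg; case: asboolP.
Qed.

Lemma visits_agree n A N x y : window n A ->
  (forall s, (s < N + 2 * n)%N -> x (- n%:Z + s%:Z) = y (- n%:Z + s%:Z)) ->
  visits A N x = visits A N y.
Proof.
move=> wA xy; apply: eq_bigr => i _; congr nat_of_bool; apply/asbool_equiv_eq.
have ag : agree n (translate x i%:Z) (translate y i%:Z).
  move=> m le_m; rewrite /translate.
  have := ltn_ord i => lt_i.
  have := xy `|(m + i%:Z + n%:Z)%R|%N.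
  have -> : - n%:Z + `|(m + i%:Z + n%:Z)%R|%N%:Z = m + i%:Z by lia.
  by apply; lia.
by split; apply: wA => //; exact: agree_sym.
Qed.
End Visits.

Section Frequencies.
Local Open Scope ring_scope.
Context (R : realType) (k : nat) (X : set (full_shift k)).
Context (X_neq0 : X !=set0).
Context (X_shift : forall x, X x -> X (left_shift x)).
Implicit Types (A B : set (full_shift k)).

Lemma translate_in x (n : nat) : X x -> X (translate x n%:Z).
Proof.
move=> Xx; elim: n => [|n IHn].
  by have -> : translate x 0 = x by apply/funext => i; rewrite /translate addr0.
by rewrite -addn1 PoszD -translateD -left_shiftE; exact: X_shift.
Qed.

Lemma max_visits A N : exists m : nat, (exists2 x, X x & visits A N x = m) /\
  forall x, X x -> (visits A N x <= m)%N.
Proof.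
have [x0 Xx0] := X_neq0.
have exP : exists m, `[< exists2 x, X x & visits A N x = m >].
  by exists (visits A N x0); apply/asboolP; exists x0.
have ub m : `[< exists2 x, X x & visits A N x = m >] -> (m <= N)%N.
  by move=> /asboolP[x _ <-]; exact: visits_le.
case: (ex_maxnP exP ub) => m /asboolP hm max_m; exists m; split=> // x Xx.
by apply: max_m; apply/asboolP; exists x.
Qed.

(** Fekete's lemma for the subadditive sequence of maximal numbers of visits:
    [M] is the infimum of [m N / N].  The maxima are attained by points of [X],
    and cutting a long orbit segment into pieces of one fixed length bounds the
    visits along it up to an additive constant. *)
Lemma upper_frequency A : exists M : R, [/\ 0 <= M,
  (forall N, exists2 x, X x & N%:R * M <= (visits A N x)%:R) &
  forall e, 0 < e -> exists C : R, forall N x, X x ->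
    (visits A N x)%:R <= N%:R * (M + e) + C].
Proof.
have /choice[m m_max] := max_visits A.
pose S := [set ((m N.+1)%:R / N.+1%:R : R) | N in [set: nat]].
have lbS : lbound S 0 by move=> _ [N _ <-]; rewrite divr_ge0.
have infS : has_inf S by split; [exists (m 1)%:R; exists 0%N => //; rewrite divr1|exists 0].
exists (inf S); split.
- by apply: lb_le_inf => //; case: infS.
- move=> N; have [[x Xx eq_m] _] := m_max N; exists x => //; rewrite eq_m.
  case: N {eq_m} => [|N]; first by rewrite mul0r.
  rewrite mulrC -ler_pdivlMr ?ltr0n //; apply: ge_inf; first by case: infS.
  by exists N.
move=> e e0; have [_ [N0 _ <-] lt_e] := inf_adherent e0 infS.
exists N0.+1%:R => N x Xx.
rewrite ltr_pdivrMr ?ltr0n // in lt_e.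
have blocks q y : X y -> (visits A (q * N0.+1) y <= q * m N0.+1)%N.
  elim: q y => [|q IHq] y Xy; first by rewrite mul0n /visits big_ord0.
  rewrite !mulSn visitsD leq_add ?IHq //; first exact: (m_max N0.+1).2.
  exact: translate_in.
have := blocks (N %/ N0.+1)%N x Xx.
have := visits_le A (N %% N0.+1)%N (translate x (N %/ N0.+1 * N0.+1)%N%:Z).
have -> : visits A N x = (visits A (N %/ N0.+1 * N0.+1) x +
    visits A (N %% N0.+1) (translate x (N %/ N0.+1 * N0.+1)%N%:Z))%N.
  by rewrite -visitsD -divn_eq.
have := ltn_pmod N (ltn0Sn N0).
set u := visits _ _ x; set v := visits _ _ _ => lt_r le_v le_u.
have le_Mq : (N %/ N0.+1)%:R * (m N0.+1)%:R <= (N %/ N0.+1)%:R * ((inf S + e) * N0.+1%:R).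
  by rewrite ler_wpM2l // ltW.
have M0 : 0 <= inf S by apply: lb_le_inf => //; case: infS.
have le_N : (N %/ N0.+1)%:R * N0.+1%:R <= N%:R :> R by rewrite -natrM ler_nat leq_divM.
have le1 : u%:R <= (N %/ N0.+1)%:R * (m N0.+1)%:R :> R by rewrite -natrM ler_nat.
have le2 : v%:R <= N0.+1%:R :> R by rewrite ler_nat ltnW // (leq_ltn_trans le_v).
rewrite natrD lerD //; apply: (le_trans le1); apply: (le_trans le_Mq).
by rewrite [_ * N0.+1%:R]mulrC mulrA ler_wpM2r // addr_ge0 // ltW.
Qed.

(** Visits to [A] have density [a] along all orbits of [X], uniformly; the
    constant [C] absorbs short orbit segments. *)
Definition has_frequency A (a : R) := forall e, 0 < e -> exists C : R,
  forall N x, X x -> `|(visits A N x)%:R - N%:R * a| <= N%:R * e + C.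

Lemma natr_gt (x : R) : exists N : nat, x < N%:R.
Proof.
by exists (Num.bound `|x|); apply: (le_lt_trans (ler_norm _)); exact: archi_boundP.
Qed.

(** Let [M] and [M'] be the upper frequencies of [A] and of its complement; the
    point is that [M + M' <= 1].  Take a word of length [N] with at least
    [N * M'] visits to the complement, and a segment of length [K * N] whose
    density of visits to [A] is at least [M].  The word occurs in the segment,
    so about [(K - 1) * N * M + N * (1 - M')] bounds the visits to [A] in it,
    whence [M <= 1 - M'] as [N] grows. *)
Lemma linearly_recurrent_frequency A : linearly_recurrent X -> cylindrical A ->
  exists a, has_frequency A a.
Proof.
move=> [K hK] [n wA]; have [x0 Xx0] := X_neq0.
have K_gt0 : 0 < K%:R :> R.
  have [j le_K _] := hK 1%N x0 x0 0 0 isT Xx0 Xx0; rewrite ltr0n; lia.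
have [M [M0 M_att M_ub]] := upper_frequency A.
have [M' [M'0 M'_att M'_ub]] := upper_frequency (~` A).
have le1 : M + M' <= 1.
  rewrite leNgt; apply/negP => gt1; pose d := M + M' - 1.
  have d0 : 0 < d by rewrite /d; lra.
  (* with this [e] the error [K * N * e] is half of the excess [N * d] *)
  pose e := d / (2 * K%:R).
  have e0 : 0 < e by rewrite divr_gt0 // mulr_gt0.
  have Ke : K%:R * e = d / 2 by rewrite /e; field; rewrite gt_eqF.
  have [C hC] := M_ub _ e0.
  have [N hN] := natr_gt ((n%:R * d + 2 * C) / (d / 2)).
  rewrite ltr_pdivrMr ?divr_gt0 // in hN.
  case: N hN => [|N] hN.
    have [x Xx hx] := M'_att 0%N; have := hC 0%N x Xx.
    rewrite mul0r add0r /visits big_ord0 => C0.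
    have nd : 0 <= n%:R * d by rewrite mulr_ge0 // ltW.
    by rewrite mul0r in hN; lra.
  have [x Xx hx] := M'_att N.+1.
  set N' := (N.+1 + 2 * n)%N.
  have [y Xy hy] := M_att (K * N')%N.
  have [j le_K agr] := hK N' y x (- n%:Z) (- n%:Z) isT Xy Xx.
  have eq_v : visits A N.+1 x = visits A N.+1 (translate y j%:Z).
    apply: (visits_agree wA) => s lt_s; by rewrite /translate addrAC; exact: agr.
  have eK : (K * N' = j + (N.+1 + (K * N' - j - N.+1)))%N by rewrite /N' in le_K *; lia.
  have Xyj : X (translate y j%:Z) by exact: translate_in.
  have := hC j y Xy; move: hy; rewrite {2}eK !visitsD -eq_v translateD !natrD.
  have := hC (K * N' - j - N.+1)%N _ (translate_in (j + N.+1)%N Xy).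
  rewrite PoszD.
  have := congr1 (fun m : nat => m%:R : R) (visitsC A N.+1 x); rewrite natrD.
  have eN : ((K * N')%N%:R = j%:R + (N.+1%:R + (K * N' - j - N.+1)%N%:R) :> R).
    by rewrite {1}eK !natrD.
  have eKN : ((K * N')%N%:R * e = N'%:R * (d / 2)) by rewrite natrM mulrAC Ke mulrC.
  have eN' : N'%:R = N.+1%:R + 2 * n%:R :> R by rewrite /N' natrD natrM.
  have nn_ge0 : 0 <= N.+1%:R :> R by [].
  move: hx eN eKN eN' hN d0 e0 nn_ge0.
  move: (visits A j y)%:R (visits A N.+1 x)%:R (visits (~` A) N.+1 x)%:R.
  move: (visits A _ (translate y (j%:Z + N.+1%:Z)))%:R ((K * N' - j - N.+1)%N%:R : R).
  move: ((K * N')%N%:R : R) (j%:R : R) (N'%:R : R) (N.+1%:R : R) (n%:R : R).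
  rewrite /d => kn jj n' nn n0 v3 r v1 v2 w hx eN eKN eN' hN d0 e0 nn_ge0 hw h3 hy h1.
  subst kn n'.
  have ejr : (jj + r) * e <= (nn + 2 * n0) * ((M + M' - 1) / 2).
    have nn_e : 0 <= nn * e by rewrite mulr_ge0 // ltW.
    by rewrite -eKN; lra.
  nra.
have M'E : M' <= 1 - M by lra.
exists M => e e0; have [C hC] := M_ub e e0; have [C' hC'] := M'_ub e e0.
exists (`|C| + `|C'|) => N x Xx; rewrite ler_norml.
have h1 := hC N x Xx; have h2 := hC' N x Xx.
have := congr1 (fun m : nat => m%:R : R) (visitsC A N x); rewrite natrD => h3.
have h4 := ler_norm C; have h5 := ler_norm C'.
have h6 : N%:R * M' <= N%:R * (1 - M) by rewrite ler_wpM2l.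
have h7 := normr_ge0 C; have h8 := normr_ge0 C'.
by apply/andP; split; nra.
Qed.
End Frequencies.

(** * Borel probabilities from additive functions of cylindrical sets *)

(** A copy of the full shift that carries the algebra of cylindrical sets, on
    which the extension theorem is applied. *)
Definition cylinder_algebra (k : nat) : Type := full_shift k.
HB.instance Definition _ k := Pointed.on (cylinder_algebra k).

Definition cylinder_display : measure_display.
Proof. exact: default_measure_display. Qed.

HB.instance Definition _ k := @isAlgebraOfSets.Build cylinder_display
  (cylinder_algebra k) (@cylindrical k) (@cylindrical0 k) (@cylindricalU k)
  (@cylindricalC k).

Section Extension.
Local Open Scope ring_scope.
Context (R : realType) (k : nat) (f : set (full_shift k) -> R).
Context (f_ge0 : forall A, 0 <= f A).
Context (f_setT : f setT = 1).
Context (f_additive : forall A B, cylindrical A -> cylindrical B ->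
  A `&` B = set0 -> f (A `|` B) = f A + f B).

Lemma additive_set0 : f set0 = 0.
Proof.
have := f_additive (@cylindrical0 k) (@cylindrical0 k) (set0I _).
by rewrite setU0; lra.
Qed.

Lemma additive_bigsetU (F : nat -> set (full_shift k)) n :
  (forall i, cylindrical (F i)) -> trivIset setT F ->
  cylindrical (\big[setU/set0]_(i < n) F i) /\
  f (\big[setU/set0]_(i < n) F i) = \sum_(i < n) f (F i).
Proof.
move=> cF tF; elim: n => [|n [cU fU]].
  by rewrite !big_ord0; split; [exact: cylindrical0|exact: additive_set0].
rewrite !big_ord_recr /=; split; first exact: cylindricalU.
rewrite f_additive ?fU //.
apply/seteqP; split=> // x [+ Fnx]; rewrite -bigcup_mkord => -[i /= lt_i Fix].
have := tF i n I I (ex_intro _ x (conj Fix Fnx)).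
by move=> eq_in; rewrite eq_in ltnn in lt_i.
Qed.

Let content (A : set (cylinder_algebra k)) : \bar R := (f A)%:E.

Let content0 : content set0 = 0%E.
Proof. by rewrite /content additive_set0. Qed.

Let content_ge0 A : (0 <= content A)%E.
Proof. by rewrite lee_fin. Qed.

(** By compactness a cylindrical union of disjoint cylindrical sets has finitely
    many nonempty terms, so the partial sums are eventually constant. *)
Let content_sigma_additive : semi_sigma_additive content.
Proof.
move=> F mF tF mUF.
have [N hN] := cylindrical_finite_cover mUF mF (@subset_refl _ _).
apply: cvg_near_cst; exists N => // n /= le_n; apply/eqP.
have -> : \bigcup_i F i = \big[setU/set0]_(i < n) F i.
  rewrite -bigcup_mkord; apply/seteqP; split=> x; last by case=> i _; exists i.
  by move=> /hN[i /= lt_i Fix]; exists i => //=; exact: leq_trans le_n.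
by rewrite big_mkord sumEFin /content (additive_bigsetU n mF tF).2.
Qed.

HB.instance Definition _ := isMeasure.Build _ _ _ content
  content0 content_ge0 content_sigma_additive.

Let extension := measure_extension content.

Let extensionE A : cylindrical A -> extension A = (f A)%:E.
Proof. by move=> cA; exact: (@measurable_mu_extE _ _ (cylinder_algebra k) content). Qed.

Let borel_extension (A : set (borel k)) : \bar R := extension A.

Let borel_measurable (A : set (borel k)) : measurable A ->
  measurable (A : set (g_sigma_algebraType (@measurable _ (cylinder_algebra k)))).
Proof. by rewrite /measurable /= -sigma_cylindrical. Qed.

Let borel_extension0 : borel_extension set0 = 0%E.
Proof. exact: (measure0 extension). Qed.

Let borel_extension_ge0 A : (0 <= borel_extension A)%E.
Proof. exact: (measure_ge0 extension). Qed.

Let borel_extension_sigma_additive : semi_sigma_additive borel_extension.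
Proof.
move=> F mF tF mUF; apply: (@measure_semi_sigma_additive _ _ _ extension) => //.
  by move=> i; exact: borel_measurable.
exact: borel_measurable.
Qed.

HB.instance Definition _ := isMeasure.Build _ _ _ borel_extension
  borel_extension0 borel_extension_ge0 borel_extension_sigma_additive.

Let borel_extensionT : borel_extension setT = 1%E.
Proof.
rewrite /borel_extension extensionE ?f_setT // -setC0.
exact/cylindricalC/cylindrical0.
Qed.

HB.instance Definition _ :=
  Measure_isProbability.Build _ _ _ borel_extension borel_extensionT.

Lemma additive_extends : exists mu : probability (borel k) R,
  forall A, cylindrical A -> mu A = (f A)%:E.
Proof. by exists borel_extension => A; exact: extensionE. Qed.
End Extension.

(** * Unique ergodicity from uniform frequencies *)

Section Borel.
Context (R : realType) (k : nat).

Lemma measurable_cylindrical (A : set (borel k)) : cylindrical A -> measurable A.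
Proof. by move=> cA; apply: sub_sigma_algebra; exact: cylindrical_open. Qed.

Lemma cylindrical_setI : setI_closed (@cylindrical k).
Proof.
move=> A B cA cB; rewrite -[A `&` B]setCK setCI.
exact/cylindricalC/cylindricalU/cylindricalC/cB/cylindricalC.
Qed.

Lemma borel_probability_unique (mu nu : probability (borel k) R) :
  (forall A, cylindrical A -> mu A = nu A) ->
  forall A : set (borel k), measurable A -> mu A = nu A.
Proof.
move=> eq_cyl A mA; apply: (@measure_unique _ R (borel k) (@cylindrical k) (fun=> setT)) => //.
- by rewrite sigma_cylindrical.
- exact: cylindrical_setI.
- by move=> _; exists 0%N.
- by rewrite bigcup_const.
- by move=> _; apply: (le_lt_trans (probability_le1 _ _)) => //; rewrite ltry.
Qed.

Lemma cylindrical_left_shift (A : set (full_shift k)) :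
  cylindrical A -> cylindrical (@left_shift k @^-1` A).
Proof.
move=> [n wA]; exists n.+1 => x y xy; apply: wA => i le_i.
rewrite /left_shift; apply: xy; lia.
Qed.

Lemma measurable_left_shift :
  measurable_fun [set: borel k] (@left_shift k : borel k -> borel k).
Proof.
apply: (@measurability _ _ (borel k) (borel k) setT (@left_shift k) (@cylindrical k)).
  by rewrite sigma_cylindrical.
move=> _ [A cA <-]; rewrite setTI; apply: measurable_cylindrical.
exact: cylindrical_left_shift.
Qed.
End Borel.

Section UniqueErgodicity.
Local Open Scope ring_scope.
Context (R : realType) (k : nat) (X : set (full_shift k)).
Context (X_neq0 : X !=set0).
Context (X_shift : forall x, X x -> X (left_shift x)).
Local Notation has_freq := (@has_frequency R k X).
Implicit Types (A B : set (full_shift k)).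

Lemma has_frequency_unique A a b : has_freq A a -> has_freq A b -> a = b.
Proof.
have [x0 Xx0] := X_neq0; move=> hA hB; apply/eqP; rewrite -subr_eq0; apply/negPn/negP => neq.
pose e := `|a - b| / 4.
have e0 : 0 < e by rewrite divr_gt0 // normr_gt0.
have [C hC] := hA e e0; have [C' hC'] := hB e e0.
have e20 : 0 < 2 * e by rewrite mulr_gt0.
have [N hN] := natr_gt ((C + C') / (2 * e)).
rewrite ltr_pdivrMr // in hN.
have := lerD (hC N x0 Xx0) (hC' N x0 Xx0); rewrite distrC.
move=> /(le_trans (ler_normD _ _)).
rewrite addrA subrK -mulrBr normrM normr_nat.
have -> : `|a - b| = 4 * e by rewrite /e; field.
by lra.
Qed.

Lemma has_frequencyC A a : has_freq A a -> has_freq (~` A) (1 - a).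
Proof.
move=> hA e e0; have [C hC] := hA e e0; exists C => N x Xx.
have := congr1 (fun m : nat => m%:R : R) (visitsC A N x); rewrite natrD => h3.
have := hC N x Xx; rewrite !ler_norml => /andP[h1 h2]; apply/andP; split; lra.
Qed.

Lemma has_frequency_ge0 A a : has_freq A a -> 0 <= a.
Proof.
have [x0 Xx0] := X_neq0; move=> hA; rewrite leNgt; apply/negP => a0.
have e0 : 0 < - a / 2 by rewrite divr_gt0 // oppr_gt0.
have [C hC] := hA _ e0; have [N hN] := natr_gt (C / (- a / 2)).
rewrite ltr_pdivrMr // in hN; have := hC N x0 Xx0.
rewrite ler_norml => /andP[_]; have : 0 <= (visits A N x0)%:R :> R by [].
lra.
Qed.

Lemma has_frequencyT : has_freq setT 1.
Proof.
move=> e e0; exists 0 => N x Xx; rewrite mulr1 addr0.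
suff -> : visits setT N x = N by rewrite subrr normr0 mulr_ge0 // ltW.
rewrite /visits -[RHS]card_ord -sum1_card; apply: eq_bigr => i _.
by rewrite asboolT.
Qed.

Lemma has_frequency0 A : (forall x, X x -> ~ A x) -> has_freq A 0.
Proof.
move=> XA e e0; exists 0 => N x Xx; rewrite mulr0 addr0 subr0.
suff -> : visits A N x = 0%N by rewrite normr0 mulr_ge0 // ltW.
rewrite /visits big1 // => i _; case: asboolP => // Ax.
by case: (XA (translate x i%:Z)) => //; exact: translate_in.
Qed.

Lemma has_frequencyD A B a b : A `&` B = set0 ->
  has_freq A a -> has_freq B b -> has_freq (A `|` B) (a + b).
Proof.
move=> AB0 hA hB e e0; have e20 : 0 < e / 2 by rewrite divr_gt0.
have [C hC] := hA _ e20; have [C' hC'] := hB _ e20; exists (C + C') => N x Xx.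
have -> : visits (A `|` B) N x = (visits A N x + visits B N x)%N.
  rewrite -big_split /=; apply: eq_bigr => i _; rewrite asbool_or.
  case: asboolP => [Ax|]; case: asboolP => [Bx|] //.
  by have : (A `&` B) (translate x i) by []; rewrite AB0.
have := lerD (hC N x Xx) (hC' N x Xx); move=> /(le_trans (ler_normD _ _)).
rewrite natrD mulrDr => h; have -> : forall u v w z : R, u + v - (w + z) = u - w + (v - z).
  by move=> *; ring.
by apply: (le_trans h); lra.
Qed.

Lemma has_frequency_shift A a :
  has_freq A a -> has_freq (@left_shift k @^-1` A) a.
Proof.
move=> hA e e0; have [C hC] := hA e e0; exists C => N x Xx.
suff -> : visits (@left_shift k @^-1` A) N x = visits A N (left_shift x).
  exact/hC/X_shift.
apply: eq_bigr => i _; congr (nat_of_bool `[< A _ >]).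
by apply/funext => j; rewrite /translate /left_shift; congr (x _); ring.
Qed.

(** Integrate over [X] the number of visits to [A] before time [N]: by
    invariance the integral is [N * nu A], and by uniformity the integrand is at
    most [N * (a + e) + C]. *)
Lemma invariant_probability_le (nu : probability (borel k) R) A a :
  measurable (X : set (borel k)) ->
  invariant_probability X nu -> cylindrical A -> has_freq A a -> (nu A <= a%:E)%E.
Proof.
have [x0 Xx0] := X_neq0; move=> mX [nuX nu_inv] cA hA.
have translate0 : [set x | A (translate x 0%:Z)] = A.
  apply/funext => x /=; congr (A _); apply/funext => j.
  by rewrite /translate addr0.
have translateS (i : nat) : [set x | A (translate x i.+1%:Z)] =
    @left_shift k @^-1` [set x | A (translate x i%:Z)].
  by apply/funext => x /=; rewrite left_shiftE translateD -PoszD add1n.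
have cAi (i : nat) : cylindrical [set x | A (translate x i%:Z)].
  elim: i => [|i IHi]; first by rewrite translate0.
  by rewrite translateS; exact: cylindrical_left_shift.
have nuAi (i : nat) : nu [set x | A (translate x i%:Z)] = nu A.
  elim: i => [|i IHi]; first by rewrite translate0.
  by rewrite translateS nu_inv //; exact: measurable_cylindrical.
have nuIX (B : set (borel k)) : measurable B -> nu (B `&` X) = nu B.
  move=> mB.
  have nuCX : nu (~` X : set (borel k)) = 0%E.
    by rewrite probability_setC // nuX subee.
  have nuBX : nu (B `\` X) = 0%E.
    apply: (subset_measure0 _ _ _ nuCX); [exact: measurableD|exact: measurableC|].
    exact: subIsetr.
  apply: esym; apply: (etrans (measureDI nu mB mX)).
  by apply: (etrans (congr1 (fun z => z + _)%E nuBX)); exact: add0e.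
have mAi i : measurable ([set x | A (translate x i%:Z)] : set (borel k)).
  exact: measurable_cylindrical.
have mfAi (i : nat) : measurable_fun (X : set (borel k))
    ((fun x => (\1_[set x | A (translate x i%:Z)] x)%:E) : borel k -> \bar R).
  by apply/measurable_EFinP; exact: measurable_indic.
have nuA_fin : nu A = (fine (nu A))%:E.
  by rewrite fineK // fin_num_measure //; exact: measurable_cylindrical.
rewrite nuA_fin lee_fin; apply/ler_addgt0Pr => e e0.
have e20 : 0 < e / 2 by rewrite divr_gt0.
have [C hC] := hA _ e20.
have [N hN] := natr_gt (C / (e / 2)); rewrite ltr_pdivrMr // in hN.
have int_eq : (\int[nu]_(x in X) (\sum_(i < N) (\1_[set x | A (translate x i%:Z)] x)%:E) =
    (N%:R * fine (nu A))%:E)%E.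
  rewrite ge0_integral_sum //.
  under eq_bigr => i _.
    rewrite (_ : integral _ _ _ = (fine (nu A))%:E); first over.
    by rewrite integral_indic // -nuA_fin; exact: etrans (nuIX _ (mAi i)) (nuAi i).
  by rewrite sumEFin sumr_const card_ord mulr_natl.
have int_le : (\int[nu]_(x in X) (\sum_(i < N) (\1_[set x | A (translate x i%:Z)] x)%:E) <=
    (N%:R * a + N%:R * (e / 2) + C)%:E)%E.
  have bound x : X x -> \sum_(i < N) \1_[set x | A (translate x i%:Z)] x <=
      N%:R * a + N%:R * (e / 2) + C :> R.
    move=> Xx; have := hC N x Xx; rewrite ler_norml => /andP[_].
    have -> : (visits A N x)%:R = \sum_(i < N) \1_[set x | A (translate x i%:Z)] x :> R.
      rewrite /visits natr_sum; apply: eq_bigr => i _; by rewrite indicE.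
    lra.
  apply: (@le_trans _ _ (\int[nu]_(x in X) cst (N%:R * a + N%:R * (e / 2) + C)%:E x)%E).
    apply: ge0_le_integral => //.
    - by move=> x _; apply: sume_ge0 => i _; rewrite lee_fin.
    - exact: emeasurable_sum.
    - by move=> x Xx; rewrite sumEFin lee_fin; exact: bound.
  by rewrite integral_cst // [X in (_ * X)%E]nuX mule1.
rewrite int_eq lee_fin in int_le.
have [N0|N_gt0] := posnP N.
  rewrite N0 !mul0r !add0r in hN int_le *; lra.
have NR_gt0 : 0 < N%:R :> R by rewrite ltr0n.
rewrite -(ler_pM2l NR_gt0) mulrDr; lra.
Qed.
(** The upper bound applied to the complement of [A] is the lower bound. *)
Lemma invariant_probabilityE (nu : probability (borel k) R) A a :
  measurable (X : set (borel k)) ->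
  invariant_probability X nu -> cylindrical A -> has_freq A a -> nu A = a%:E.
Proof.
move=> mX nu_inv cA hA; have mA := measurable_cylindrical cA.
apply/eqP; rewrite eq_le invariant_probability_le //=.
have := invariant_probability_le mX nu_inv (cylindricalC cA) (has_frequencyC hA).
rewrite probability_setC // EFinB => h.
have nuA_fin : nu A = (fine (nu A))%:E by rewrite fineK // fin_num_measure.
rewrite nuA_fin -!EFinB !lee_fin in h *; lra.
Qed.

(** Frequencies of cylindrical sets are additive, so they extend to a Borel
    probability; it is invariant because frequencies are, and it is carried by
    [X] because a cylindrical set disjoint from [X] is never visited.  Any other
    invariant probability has the same values on cylindrical sets. *)
Lemma linearly_recurrent_uniquely_ergodic :
  closed X -> linearly_recurrent X -> uniquely_ergodic R X.
Proof.
move=> clX LR; have mX : measurable (X : set (borel k)).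
  rewrite -[X]setCK; apply: measurableC; apply: sub_sigma_algebra.
  exact: closed_openC.
pose f A := xget 0 [set a | has_freq A a].
have fE A a : has_freq A a -> f A = a.
  move=> hA; apply: (has_frequency_unique (A := A)) => //.
  exact: (@xgetPex _ 0 [set a | has_freq A a] (ex_intro _ a hA)).
have has_f A : cylindrical A -> has_freq A (f A).
  move=> cA; have [a hA] := linearly_recurrent_frequency R X_neq0 X_shift LR cA.
  by rewrite (fE _ _ hA).
have f_ge0 A : 0 <= f A.
  rewrite /f; case: xgetP => // a _; exact: has_frequency_ge0.
have [mu muE] : exists mu : probability (borel k) R,
    forall A, cylindrical A -> mu A = (f A)%:E.
  apply: additive_extends => //; first exact/fE/has_frequencyT.
  by move=> A B cA cB AB0; apply: fE; apply: has_frequencyD => //; exact: has_f.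
exists mu; split; last first.
  move=> nu nu_inv; apply: borel_probability_unique => A cA.
  by rewrite muE //; apply: invariant_probabilityE => //; exact: has_f.
split.
  have muCX : mu (~` X : set (borel k)) = 0%E.
    have cover := open_bigcup_window (closed_openC clX).
    have cU n : cylindrical [set x | forall y, agree n x y -> (~` X) y].
      by exists n; exact: window_interior.
    have muU n : mu [set x | forall y, agree n x y -> (~` X) y] = 0%E.
      rewrite muE // (fE _ 0) //; apply: has_frequency0 => x Xx.
      by move=> /(_ x (@agree_refl _ _ _)).
    apply: measure_negligible; first exact: measurableC.
    rewrite cover; apply: negligible_bigcup => n; apply/negligibleP; last exact: muU.
    exact: measurable_cylindrical.
  have h := probability_setC mu (measurableC mX); rewrite setCK in h.
  by apply: (etrans h); rewrite [X in (1 - X)%E]muCX sube0.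
move=> A mA.
pose S : {mfun borel k >-> borel k} := mfun_Sub (mem_set (@measurable_left_shift k)).
have := @borel_probability_unique R k (distribution mu S) mu _ A mA; apply.
move=> B cB; apply: (@etrans _ _ (mu (@left_shift k @^-1` B))) => //.
rewrite !muE //; last exact: cylindrical_left_shift.
by congr (_%:E); apply: fE; apply: has_frequency_shift; exact: has_f.
Qed.
End UniqueErgodicity.

Section StrictErgodicity.
Local Open Scope ring_scope.

Lemma linearly_recurrent_minimal k (X : set (full_shift k)) :
  linearly_recurrent X -> minimal X.
Proof.
move=> [K hK] x Xx x' Xx' U /agree_nbhs[n hn].
have [j _ agr] := hK (2 * n).+1 x x' (- n%:Z) 0 isT Xx Xx'.
exists (translate x (j%:Z + n%:Z)); split; first by exists (j%:Z + n%:Z).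
apply: hn => i le_i.
have -> : i = - n%:Z + `|(i + n%:Z)%R|%N%:Z by lia.
rewrite agr; last by lia.
by rewrite /translate; congr (x _); lia.
Qed.

Lemma linearly_recurrent_strictly_ergodic (R : realType) k (X : set (full_shift k)) :
  X !=set0 -> subshift X -> linearly_recurrent X -> strictly_ergodic R X.
Proof.
move=> X_neq0 [clX shX] LR; split=> //; first exact: linearly_recurrent_minimal.
apply: linearly_recurrent_uniquely_ergodic => // x Xx.
by rewrite -shX in Xx.
Qed.
End StrictErgodicity.

(** * The preimage is a nonempty subshift *)

Section NonEmpty.
Context (p : nat) (p_gt0 : 0 < p).
Local Notation B := (nm_block p).

(** [B (3 * n.+1) 0] contains [B (3 * n) 0] strictly inside, after
    [B (3 * n).+2 0].  Placing the coordinate origin at position [center n] of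
    [B (3 * n) 0] makes these words nested windows of one bi-infinite sequence. *)
Definition center n : nat := \sum_(i < n) size (B (3 * i).+2 0%R).

Lemma nm_block_center n : exists2 w, 0 < size w &
  B (3 * n.+1) 0%R = B (3 * n).+2 0%R ++ B (3 * n) 0%R ++ w.
Proof.
have -> : 3 * n.+1 = (3 * n).+3 by lia.
have [v1 ->] := nm_block_prefix2 p_gt0 (3 * n).+1.
have [v2 eq2] := nm_block_prefix p_gt0 (3 * n); exists (v2 ++ v1); last by rewrite eq2 -catA.
have := congr1 size eq2; rewrite size_nm_block0S !size_cat.
have := size_nm_block_gt0 p (3 * n) 1%R.
have := leq_pmull (size (B (3 * n) 0%R)) p_gt0; lia.
Qed.

Lemma center_bounds n : n <= center n /\ center n + n < size (B (3 * n) 0%R).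
Proof.
elim: n => [|n [IH1 IH2]]; first by rewrite /center big_ord0.
have [w w_gt0 ->] := nm_block_center n; rewrite !size_cat /center big_ord_recr /=.
rewrite -/(center n); have := size_nm_block_gt0 p (3 * n).+2 0%R.
by split; lia.
Qed.

Definition nm_point : full_shift 2 := fun i : int =>
  nth 0%R (B (3 * `|i|%N) 0%R) `|((center `|i|%N)%:Z + i)%R|%N.

Lemma nm_pointE n (i : int) : `|i|%N <= n ->
  nm_point i = nth 0%R (B (3 * n) 0%R) `|((center n)%:Z + i)%R|%N.
Proof.
move/subnK <-; elim: (n - _) => // d ->; rewrite addSn.
have : `|i|%N <= d + `|i|%N by exact: leq_addl.
move: (d + _)%N => m le_i; have [w _ ->] := nm_block_center m.
have [h1 h2] := center_bounds m.
have -> : center m.+1 = center m + size (B (3 * m).+2 0%R).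
  by rewrite /center big_ord_recr.
rewrite !nth_cat; move: (size (B (3 * m).+2 0%R)) => s.
rewrite ifF; last by apply/negbTE; rewrite -leqNgt; lia.
have -> : `|((center m + s)%N%:Z + i)%R|%N - s = `|((center m)%:Z + i)%R|%N by lia.
rewrite ifT //; apply: leq_trans h2; lia.
Qed.

Lemma X_nm_point : X_nm p nm_point.
Proof.
move=> i m; pose n := (`|i|%N + m).+1; exists (3 * n) => //.
have [h1 h2] := center_bounds n.
pose a := `|((center n)%:Z + i)%R|%N.
have le_a : a + m <= size (B (3 * n) 0%R).
  apply: leq_trans (ltnW h2); rewrite /a.
  by move: (center n) h1; rewrite /n => c h1; lia.
have -> : [seq nm_point (i + j%:Z)%R | j <- iota 0 m] = take m (drop a (B (3 * n) 0%R)).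
  apply: (@eq_from_nth _ 0%R).
    rewrite size_map size_iota size_takel // size_drop leq_subRL //.
    exact: leq_trans (leq_addr _ _) le_a.
  move=> j; rewrite size_map size_iota => lt_j.
  rewrite (nth_map 0) ?size_iota // nth_iota // add0n nth_take // nth_drop.
  rewrite (@nm_pointE n); last by rewrite /n; lia.
  by congr (nth _ _); rewrite /a; move: (center n) h1; rewrite /n => c h1; lia.
apply: (@infix_trans _ (drop a (B (3 * n) 0%R))); first exact/prefixW/prefix_take.
exact/suffixW/suffix_drop.
Qed.
End NonEmpty.

Lemma int_antiderivative (V : zmodType) (g : int -> V) :
  exists f : int -> V, forall q, f (q + 1)%R = (f q + g q)%R.
Proof.
exists (fun q => match q with
  | Posz n => \sum_(j < n) g j%:Z
  | Negz n => - \sum_(j < n.+1) g (Negz j) end)%R.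
case=> [n|[|n]].
- by rewrite -PoszD addn1 big_ord_recr.
- have -> : (Negz 0 + 1 = 0 :> int)%R by [].
  by rewrite big_ord1 big_ord0 addNr.
have -> : (Negz n.+1 + 1 = Negz n :> int)%R by lia.
by rewrite [in RHS]big_ord_recr /= opprD addrNK.
Qed.

(** Along each residue class modulo [L.+1] this is the case of step one. *)
Lemma int_step_antiderivative (V : zmodType) (L : nat) (g : int -> V) :
  exists f : int -> V, forall q, f (q + L.+1%:Z)%R = (f q + g q)%R.
Proof.
have /choice[F hF] (r : int) := int_antiderivative (fun q => g (q * L.+1%:Z + r)%R).
exists (fun n => F (n %% L.+1%:Z)%Z (n %/ L.+1%:Z)%Z) => q.
by rewrite modzDr divzDr ?dvdzz // divzz /= hF -divz_eq.
Qed.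

Section PreimageSubshift.
Context (p : nat) (p_gt0 : 0 < p) (k L : nat).
Local Notation Y := (eta k L.+2 @^-1` X_nm_in k p).

Lemma eta_preimage_neq0 : Y !=set0.
Proof.
have [x hx] := int_step_antiderivative L
  (fun n => (val (nm_point p n))%:R%R : 'Z_k).
exists x; apply/mem_eta_preimage; exists (nm_point p); first exact: X_nm_point.
move=> n; rewrite /eta (_ : (n + L.+2%:Z - 1 = n + L.+1%:Z)%R); last by lia.
by rewrite hx addrAC subrr add0r.
Qed.

Lemma codes_inj z x m : @codes k L z x ->
  z m = (if x (m + L.+1%:Z)%R == x m then 0 else 1)%R.
Proof.
move=> zx; rewrite (codesE m zx) -{2}[x m]addr0 (inj_eq (addrI _)).
have [->|->] := Z2_cases (z m); first by rewrite eqxx.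
by rewrite [val _]/= oner_eq0.
Qed.

(** The coding sequence of a point is determined locally, as [codes_inj] shows,
    so a limit of points of the preimage is coded by a sequence [z] whose windows
    are windows of points of [X_nm]. *)
Lemma eta_preimage_closed : closed Y.
Proof.
apply: closed_agree => x hx.
pose z : full_shift 2 := fun m => (if x (m + L.+1%:Z)%R == x m then 0 else 1)%R.
have approx n : exists z', [/\ X_nm p z', exists2 x', @codes k L z' x' & agree (n + L.+1) x x' &
    forall m : int, `|m|%N <= n -> z m = z' m].
  have [x' /mem_eta_preimage[z' Xz' zx'] ag] := hx (n + L.+1).
  exists z'; split=> //; first by exists x'.
  move=> m le_m; rewrite (codes_inj m zx') /z !ag //; lia.
apply/mem_eta_preimage; exists z => [i m|m].
  have [z' [Xz' _ zz']] := approx (`|i|%N + m).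
  have [n n_gt0 inf_n] := Xz' i m; exists n => //.
  rewrite (_ : [seq z _ | j <- _] = [seq z' (i + j%:Z)%R | j <- iota 0 m]) //.
  apply/eq_in_map => j; rewrite mem_iota => lt_j; apply: zz'; lia.
have [z' [_ [x' zx' ag] zz']] := approx `|m|%N.
rewrite zz' // -zx' /eta !ag //; lia.
Qed.

Lemma eta_preimage_shift : @left_shift k @^-1` Y = Y.
Proof.
apply/seteqP; split=> x /mem_eta_preimage[z Xz zx]; apply/mem_eta_preimage.
  exists (fun n => z (n - 1)%R) => [i m|n].
    have [n n_gt0 inf_n] := Xz (i - 1)%R m; exists n => //.
    rewrite (_ : [seq _ | j <- _] = [seq z (i - 1 + j%:Z)%R | j <- iota 0 m]) //.
    by apply: eq_map => j; rewrite addrAC.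
  rewrite -zx /eta /left_shift; congr (x _ - x _)%R; lia.
exists (fun n => z (n + 1)%R) => [i m|n].
  have [n n_gt0 inf_n] := Xz (i + 1)%R m; exists n => //.
  rewrite (_ : [seq _ | j <- _] = [seq z (i + 1 + j%:Z)%R | j <- iota 0 m]) //.
  by apply: eq_map => j; rewrite addrAC.
rewrite -zx /eta /left_shift; congr (x _ - x _)%R; lia.
Qed.
End PreimageSubshift.

Theorem theorem1p6 (R : realType) (p : nat) (hp : (1 <= p)%N)
    (k l : nat) (hk : (2 <= k)%N) (hl : (2 <= l)%N) :
  strictly_ergodic R (eta k l @^-1` X_nm_in k p).
Proof.
case: l hl => [|[|L]] // _; apply: linearly_recurrent_strictly_ergodic.
- exact: eta_preimage_neq0.
- by split; [exact: eta_preimage_closed|exact: eta_preimage_shift].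
- exact: eta_preimage_linearly_recurrent.
Qed.
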